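(* Let $F :\subseteq \mathrm{Reg} \times \mathrm{Reg} \to \mathrm{Reg}$ be computed by an oracle Turing machine whose running time is bounded by a second-order polynomial $P$ (the pair $(\psi,\varphi)$ being supplied as the oracle $\langle \psi, \varphi\rangle$). Then there is no $\psi \in \mathrm{Reg}$ such that $F(\psi, \varphi) = \Phi_{\deg(P)+1}(\varphi)$ for all $\varphi \in \mathrm{Reg}$.
   Context: Fix a finite alphabet $\Sigma$. A total function $\varphi:\Sigma^*\to\Sigma^*$ is regular if $|u|\le|v|$ implies $|\varphi(u)|\le|\varphi(v)|$; its size $|\varphi|:\mathbb{N}\to\mathbb{N}$ is defined by $|\varphi|(|u|)=|\varphi(u)|$. Let $\mathrm{mon}$ be the set of strictly monotone functions $\mathbb{N}\to\mathbb{N}$ and $\mathrm{Reg}$ the set of regular $\varphi$ with $|\varphi|\in\mathrm{mon}$. A polynomial-time pairing $\langle\cdot,\cdot\rangle:\Sigma^*\times\Sigma^*\to\Sigma^*$ with $|\langle u,v\rangle|=|u|\cdot|v|$ is fixed and lifted to $\mathrm{Reg}$ by $\langle\varphi,\psi\rangle(u)=\langle\varphi(u),\psi(u)\rangle$. Second-order polynomials (in a type-1 variable $\mathtt{L}$ and a type-0 variable $\mathtt{n}$) are defined inductively: every positive integer and $\mathtt{n}$ are second-order polynomials, and if $P,Q$ are, so are $P+Q$, $P\cdot Q$ and $\mathtt{L}(P)$. A second-order polynomial $P$ defines a map $p\mapsto P(p)$ from $\mathrm{mon}$ to functions $\mathbb{N}\to\mathbb{N}$ by interpreting $\mathtt{L}$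 as $p$. An oracle Turing machine computes $F:\subseteq\mathrm{Reg}\to\mathrm{Reg}$ if for each $\varphi\in\mathrm{dom}F$ and string $u$ it outputs $F(\varphi)(u)$ on oracle $\varphi$ and input $u$; its running time is bounded by $P$ if on every oracle $\varphi\in\mathrm{Reg}$ and input $u$ it halts within $P(|\varphi|)(|u|)$ steps. The second-order degree $\deg$ is defined together with an auxiliary type in $\{\mathbf{a},\mathbf{m}\}$: $\deg(1)=\deg(\mathtt{n})=0$ (any positive integer constant likewise), both of type $\mathbf{m}$; $\deg(\mathtt{L}(P))=\deg(P)+1$, of type $\mathbf{a}$; for $P+Q$ and $P\cdot Q$ let $d=\max\{\deg P,\deg Q\}$ and say the pair is ''critical'' if $P$ has type $\mathbf{a}$ and $\deg P=d$, or $Q$ has type $\mathbf{a}$ and $\deg Q=d$; then $\deg(P+Q)=d$ with type $\mathbf{a}$ if critical and $\mathbf{m}$ otherwise; $\deg(P\cdot Q)=d+1$ if critical and $d$ otherwise, and $P\cdot Q$ always has type $\mathbf{m}$. Define $\Phi_n:\mathrm{Reg}\to\mathrm{Reg}$ by $\Phi_0(\varphi)(w)=w$ and $\Phi_{n+1}(\varphi)(w)=\varphi(\Phi_n(\varphi)(w))$. *)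

(* Defs.v *)
From HB Require Import structures.
From mathcomp Require Import all_boot all_algebra.

Set Implicit Arguments.
Unset Strict Implicit.
Unset Printing Implicit Defensive.

Definition mon (p : nat -> nat) : Prop := {homo p : m n / m < n}.

Section Regular.
Variable Sigma : finType.
Implicit Types (f g : seq Sigma -> seq Sigma) (u v w : seq Sigma).

Definition regular f : Prop :=
  forall u v, size u <= size v -> size (f u) <= size (f v).

(* The size |f|.  All the terms of the maximum are equal when f is regular,
   so that |f|(|u|) = |f(u)| by [fsizeE]. *)
Definition fsize f (n : nat) : nat := \max_(t : n.-tuple Sigma) size (f t).

Record Reg := MkReg {
  reg_fun :> seq Sigma -> seq Sigma;
  reg_regular : regular reg_fun;
  reg_mon : mon (fsize reg_fun) }.

Lemma fsizeE f u : regular f -> fsize f (size u) = size (f u).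
Proof.
move=> rf; apply/eqP; rewrite eqn_leq; apply/andP; split.
  by apply/bigmax_leqP => t _; apply: rf; rewrite size_tuple.
exact: (leq_bigmax (in_tuple u)).
Qed.

Lemma reg_size_lt (phi : Reg) u v :
  size u < size v -> size (phi u) < size (phi v).
Proof.
by move=> /(reg_mon phi); rewrite !fsizeE //; apply: reg_regular.
Qed.

(* On the empty alphabet there is no strictly monotone size, so that any
   regular function in Reg provides a letter. *)
Lemma reg_letter (phi : Reg) : exists a : Sigma, true.
Proof.
case: (pickP (mem Sigma)) => [a _|noa]; first by exists a.
have := reg_mon phi (ltn0Sn 0); rewrite {2}/fsize big1 ?ltn0 // => t _.
by have := noa (thead t).
Qed.

Lemma mon_fsize (phi : Reg) f : regular f ->
  (forall u v, size u < size v -> size (f u) < size (f v)) -> mon (fsize f).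
Proof.
move=> rf f_lt m n lt_mn; have [a _] := reg_letter phi.
rewrite -(size_nseq m a) -(size_nseq n a) !fsizeE //.
by apply: f_lt; rewrite !size_nseq.
Qed.

Definition Phi_fun (n : nat) (phi : Reg) w : seq Sigma := iter n phi w.

Lemma Phi_regular n phi : regular (Phi_fun n phi).
Proof.
rewrite /Phi_fun => u v le_uv.
by elim: n => //= n; apply: reg_regular.
Qed.

Lemma Phi_mon n phi : mon (fsize (Phi_fun n phi)).
Proof.
apply: (mon_fsize phi) => [|u v lt_uv]; first exact: Phi_regular.
rewrite /Phi_fun.
by elim: n => //= n; apply: reg_size_lt.
Qed.

Definition Phi (n : nat) (phi : Reg) : Reg :=
  MkReg (@Phi_regular n phi) (@Phi_mon n phi).

End Regular.

Inductive sopoly : Type :=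
| SConst (c : nat) of 0 < c
| SVar
| SAdd of sopoly & sopoly
| SMul of sopoly & sopoly
| SApp of sopoly.

Fixpoint sopeval (P : sopoly) (p : nat -> nat) (n : nat) : nat :=
  match P with
  | SConst c _ => c
  | SVar => n
  | SAdd P Q => sopeval P p n + sopeval Q p n
  | SMul P Q => sopeval P p n * sopeval Q p n
  | SApp P => p (sopeval P p n)
  end.

(* A degree together with its type, where true stands for the type a and false
   for the type m. *)
Definition critical (x y : nat * bool) : bool :=
  let d := maxn x.1 y.1 in
  (x.2 && (x.1 == d)) || (y.2 && (y.1 == d)).

Fixpoint sodeg_type (P : sopoly) : nat * bool :=
  match P with
  | SConst _ _ => (0, false)
  | SVar => (0, false)
  | SAdd P Q =>
      let x := sodeg_type P in let y := sodeg_type Q in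
      (maxn x.1 y.1, critical x y)
  | SMul P Q =>
      let x := sodeg_type P in let y := sodeg_type Q in
      (if critical x y then (maxn x.1 y.1).+1 else maxn x.1 y.1, false)
  | SApp P => ((sodeg_type P).1.+1, true)
  end.

Definition sodeg (P : sopoly) : nat := (sodeg_type P).1.

(* The tapes of a machine with m inputs and k work tapes. *)
Inductive tape_name (m k : nat) : Type :=
| Input of 'I_m
| Work of 'I_k
| Query
| Answer
| Output.
Arguments Input {m k}.
Arguments Work {m k}.
Arguments Query {m k}.
Arguments Answer {m k}.
Arguments Output {m k}.

Section TapeNameFinite.
Variables m k : nat.

Definition tape_code (t : tape_name m k) : 'I_m + 'I_k + 'I_3 :=
  match t with
  | Input i => inl (inl i)
  | Work j => inl (inr j)
  | Query => inr (@Ordinal 3 0 isT)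
  | Answer => inr (@Ordinal 3 1 isT)
  | Output => inr (@Ordinal 3 2 isT)
  end.

Definition tape_decode (c : 'I_m + 'I_k + 'I_3) : tape_name m k :=
  match c with
  | inl (inl i) => Input i
  | inl (inr j) => Work j
  | inr r => nth Output [:: Query; Answer] r
  end.

Lemma tape_codeK : cancel tape_code tape_decode.
Proof. by case. Qed.

HB.instance Definition _ :=
  Finite.copy (tape_name m k) (can_type tape_codeK).

End TapeNameFinite.

Inductive move : Type := MoveLeft | Stay | MoveRight.

(* A tape has the cells 0, 1, 2, ...; those beyond the size of [cells] are
   blank.  The head stays put when moved to the left of cell 0. *)
Record tape (X : Type) := MkTape { cells : seq X; head_pos : nat }.

Section Machines.
Variable Sigma : finType.

(* The tape symbols are the blank None, the letters and the auxiliary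
   symbols of the machine. *)
Definition symbol (aux : finType) : Type := option (Sigma + aux).

(* In a state q with ask q = Some q' the oracle is consulted and the machine
   goes into the state q'.  In the other states but the halting one, delta
   gives the next state and, on each tape, the symbol to be written and the
   move of the head, as a function of the symbols under the heads. *)
Record oracle_machine (m : nat) := OracleMachine {
  state : finType;
  aux : finType;
  nwork : nat;
  start : state;
  halt : state;
  ask : state -> option state;
  delta : state -> {ffun tape_name m nwork -> symbol aux} ->
          state * (tape_name m nwork -> symbol aux * move) }.

Section Run.
Variables (m : nat) (M : oracle_machine m).
Notation tapes := (tape_name m (nwork M)).
Notation sym := (symbol (aux M)).

Record config := Config { cstate : state M; ctape : tapes -> tape sym }.

Definition blank_tape : tape sym := MkTape [::] 0.

Definition letter (a : Sigma) : sym := Some (inl a).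

Definition unletter (x : sym) : option Sigma :=
  if x is Some (inl a) then Some a else None.

Definition word_tape (u : seq Sigma) : tape sym := MkTape (map letter u) 0.

(* The word on a tape extends from cell 0 up to the first symbol that is not
   a letter. *)
Definition tape_word (t : tape sym) : seq Sigma :=
  pmap unletter (take (find (fun x => ~~ unletter x) (cells t)) (cells t)).

Definition tape_read (t : tape sym) : sym := nth None (cells t) (head_pos t).

Definition tape_update (t : tape sym) (xd : sym * move) : tape sym :=
  MkTape (set_nth None (cells t) (head_pos t) xd.1)
    (match xd.2 with
     | MoveLeft => (head_pos t).-1
     | Stay => head_pos t
     | MoveRight => (head_pos t).+1
     end).

Definition init_config (us : m.-tuple (seq Sigma)) : config :=
  Config (start M)
    (fun t => if t is Input i then word_tape (tnth us i) else blank_tape).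

Definition halted (c : config) : bool := cstate c == halt M.

(* Consulting the oracle takes one step: the answer to the word on the query
   tape replaces the content of the answer tape, the query tape is erased, and
   the heads of both tapes return to cell 0. *)
Definition step (phi : seq Sigma -> seq Sigma) (c : config) : config :=
  if halted c then c
  else if ask (cstate c) is Some q then
    Config q (fun t => match t with
      | Query => blank_tape
      | Answer => word_tape (phi (tape_word (ctape c Query)))
      | _ => ctape c t
      end)
  else
    let r := delta (cstate c) [ffun t => tape_read (ctape c t)] in
    Config r.1 (fun t => tape_update (ctape c t) (r.2 t)).

Definition run phi (us : m.-tuple (seq Sigma)) (t : nat) : config :=
  iter t (step phi) (init_config us).

Definition halts_within phi us (N : nat) : Prop :=
  exists2 t, t <= N & halted (run phi us t).

Definition outputs phi us (v : seq Sigma) : Prop :=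
  exists2 t, halted (run phi us t)
           & tape_word (ctape (run phi us t) Output) = v.

Definition oracle_free : Prop := forall q : state M, ask q = None.

End Run.

(* The oracle given to [outputs] and [halts_within] is a dummy, as the machine
   never consults it. *)
Definition polytime2 (f : seq Sigma -> seq Sigma -> seq Sigma) : Prop :=
  exists (M : oracle_machine 2) (q : {poly nat}),
    oracle_free M /\
    forall u v, outputs M id [tuple u; v] (f u v) /\
                halts_within M id [tuple u; v] q.[(size u + size v)%N]%R.

(* Injectivity is deliberately not required: on a nonempty alphabet no
   injective map satisfies [size_pair], because (u, v) is sent to the empty
   word as soon as u or v is empty. *)
Record pairing := Pairing {
  pair_fun :> seq Sigma -> seq Sigma -> seq Sigma;
  pair_polytime : polytime2 pair_fun;
  size_pair : forall u v, size (pair_fun u v) = size u * size v }.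

Definition reg_pair_fun (pr : pairing) (psi phi : Reg Sigma) (u : seq Sigma) :=
  pr (psi u) (phi u).

Lemma reg_pair_regular pr psi phi : regular (reg_pair_fun pr psi phi).
Proof.
move=> u v le_uv; rewrite !size_pair.
by apply: leq_mul; apply: reg_regular.
Qed.

Lemma reg_pair_mon pr psi phi : mon (fsize (reg_pair_fun pr psi phi)).
Proof.
apply: (mon_fsize phi) => [|u v lt_uv]; first exact: reg_pair_regular.
by rewrite !size_pair; apply: ltn_mul; apply: reg_size_lt.
Qed.

Definition reg_pair (pr : pairing) (psi phi : Reg Sigma) : Reg Sigma :=
  MkReg (@reg_pair_regular pr psi phi) (@reg_pair_mon pr psi phi).

(* A partial operator is undefined where it takes the value None. *)
Definition computes (pr : pairing) (M : oracle_machine 1)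
    (F : Reg Sigma * Reg Sigma -> option (Reg Sigma)) : Prop :=
  forall (psi phi G : Reg Sigma), F (psi, phi) = Some G ->
  forall u, outputs M (reg_pair pr psi phi) [tuple u] (G u).

Definition time_bounded (M : oracle_machine 1) (P : sopoly) : Prop :=
  forall (phi : Reg Sigma) (u : seq Sigma),
  halts_within M phi [tuple u] (sopeval P (fsize phi) (size u)).

End Machines.

(* Main.v *)
(** A word output within [t] steps has at most [t] letters, so it suffices to
    find a size function q for which q iterated [deg P + 1] times exceeds the
    time bound.  The nesting depth of L in P is at most [deg P].  If p is the
    size of psi, the oracle has size m |-> p m * q m; let q grow so fast that
    q (m + 1) > H (p m * q m) and q m > H m, where the polynomial H dominates
    the arithmetic of P.  Then each level of L in P is paid for by one
    application of q, and the arithmetic below all L's by another one. *)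
Require Import Defs.
From mathcomp Require Import all_boot.

Section Growth.
Implicit Types (P : sopoly) (p q r : nat -> nat).

(* The extra summands make H of P dominate H of every subterm of P. *)
Fixpoint arith_bound P (x : nat) : nat :=
  match P with
  | SConst c _ => c
  | SVar => x
  | SAdd P Q => arith_bound P x + arith_bound Q x
  | SMul P Q =>
      arith_bound P x * arith_bound Q x + (arith_bound P x + arith_bound Q x)
  | SApp P => arith_bound P x + x
  end.

Lemma leq_arith_bound P : {homo arith_bound P : x y / x <= y}.
Proof.
move=> x y le_xy; elim: P => //= [P IHP Q IHQ|P IHP Q IHQ|P IHP].
- exact: leq_add.
- by apply: leq_add; [apply: leq_mul|apply: leq_add].
- exact: leq_add.
Qed.

Lemma mon_geq p n : mon p -> n <= p n.
Proof. by move=> p_mon; elim: n => // n /leq_ltn_trans; apply; apply: p_mon. Qed.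

Lemma mon_leq p : mon p -> {homo p : m n / m <= n}.
Proof.
by move=> p_mon m n; rewrite leq_eqVlt => /predU1P[->|/p_mon/ltnW].
Qed.

(** For k > 0 this bounds r on arguments strictly below q^k(n). The predecessor turns the strict
    bound into the shift of the growth condition [H (r m) < q m.+1]. *)
Definition level r q n k : nat :=
  if k is k'.+1 then r (iter k q n).-1 else n.

Section FastGrowth.
Variables (r q : nat -> nat) (n : nat).
Hypotheses (r_mon : mon r) (q_mon : mon q) (q_gt : forall m, m < q m).

Lemma level_leq : {homo level r q n : k l / k <= l}.
Proof.
apply: homo_leq => [//|i j k|k]; first exact: leq_trans.
have le_iter j : iter j q n <= (iter j.+1 q n).-1 by rewrite -ltnS (ltn_predK (q_gt _)) q_gt.
case: k => [|k]; first exact: leq_trans (le_iter 0) (mon_geq _ _ r_mon).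
apply: (mon_leq _ r_mon).
exact: leq_trans (leq_pred _) (le_iter k.+1).
Qed.

Variable H : nat -> nat.
Hypotheses (H_lt : forall m, H m < q m) (Hr_lt : forall m, H (r m) < q m.+1).

(** For k > 0, [Hr_lt] at m = q^k(n) - 1 absorbs r and H together in a single application of q, at m
    + 1 = q^k(n). *)
Lemma level_lt k : H (level r q n k) < iter k.+1 q n.
Proof.
case: k => [|k]; first exact: H_lt.
by apply: leq_trans (Hr_lt _) _; rewrite [X in _ <= X]iterS (ltn_predK (q_gt _)).
Qed.

End FastGrowth.

(** Induction on P. The growth conditions stay in the induction statement, since each subterm
    inherits them from P. *)
Lemma sopeval_level P r q n : mon r -> mon q -> (forall m, m < q m) ->
    (forall m, arith_bound P m < q m) ->
    (forall m, arith_bound P (r m) < q m.+1) ->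
  sopeval P r n <= arith_bound P (level r q n (sodeg P)).
Proof.
move=> r_mon q_mon q_gt; rewrite /sodeg.
elim: P => //= [P IHP Q IHQ|P IHP Q IHQ|P IHP] H_lt Hr_lt.
- have {}IHP := IHP (fun m => leq_ltn_trans (leq_addr _ _) (H_lt m))
                    (fun m => leq_ltn_trans (leq_addr _ _) (Hr_lt m)).
  have {}IHQ := IHQ (fun m => leq_ltn_trans (leq_addl _ _) (H_lt m))
                    (fun m => leq_ltn_trans (leq_addl _ _) (Hr_lt m)).
  apply: leq_add; [apply: leq_trans IHP _|apply: leq_trans IHQ _];
  apply: leq_arith_bound; apply: level_leq => //;
  by rewrite ?leq_maxl ?leq_maxr.
- have leP x y : x <= x * y + (x + y) by rewrite addnCA leq_addr.
  have leQ x y : y <= x * y + (x + y) by rewrite addnA leq_addl.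
  have {}IHP := IHP (fun m => leq_ltn_trans (leP _ _) (H_lt m))
                    (fun m => leq_ltn_trans (leP _ _) (Hr_lt m)).
  have {}IHQ := IHQ (fun m => leq_ltn_trans (leQ _ _) (H_lt m))
                    (fun m => leq_ltn_trans (leQ _ _) (Hr_lt m)).
  (* Critical or not, the degree of the product is at least that of each factor, so both levels can
     be raised to it. *)
  set d := (if _ then _ else _).
  have le_d : maxn (sodeg_type P).1 (sodeg_type Q).1 <= d.
    by rewrite /d; case: ifP.
  move: le_d; rewrite geq_max => /andP[leP_d leQ_d].
  apply: leq_trans (leq_addr _ _).
  by apply: leq_mul; [apply: leq_trans IHP _|apply: leq_trans IHQ _];
     apply: leq_arith_bound; apply: level_leq.
- have {}H_lt m := leq_ltn_trans (leq_addr _ _) (H_lt m).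
  have {}Hr_lt m := leq_ltn_trans (leq_addr _ _) (Hr_lt m).
  (* With k the degree of the argument of L, that argument is at most H(level k) < q^(k+1)(n), hence
     at most q^(k+1)(n) - 1, where r takes the value level (k+1). *)
  apply: leq_trans (leq_addl _ _); apply: mon_leq => //.
  have lt_q := level_lt r q n q_gt _ H_lt Hr_lt (sodeg_type P).1.
  by rewrite -ltnS (ltn_predK lt_q); apply: leq_ltn_trans lt_q; apply: IHP.
Qed.

(** The oracle size p m * q m involves q itself, but only its value at m constrains q at m + 1, so
    recursion applies. The summands ensure, in order, the condition on H(r m), the domination of H,
    strict monotonicity and n < q n. *)
Fixpoint fast P p (n : nat) : nat :=
  if n is m.+1 then
    (arith_bound P (p m * fast P p m) + arith_bound P n + fast P p m + n).+1
  else (arith_bound P 0).+1.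

Lemma fast_mon P p : mon (fast P p).
Proof.
apply: homo_ltn => [i j k|m]; first exact: ltn_trans.
by rewrite ltnS -addnA addnCA leq_addr.
Qed.

Lemma fast_gt P p m : m < fast P p m.
Proof. by case: m => [|m] //=; rewrite ltnS leq_addl. Qed.

Lemma fast_bound P p m : arith_bound P m < fast P p m.
Proof. by case: m => [|m] //=; rewrite ltnS -2!addnA addnCA leq_addr. Qed.

Lemma fast_boundM P p m :
  arith_bound P (p m * fast P p m) < fast P p m.+1.
Proof. by rewrite /= ltnS -2!addnA leq_addr. Qed.

Lemma sopeval_lt_iter_fast P p n : mon p ->
  sopeval P (fun m => p m * fast P p m) n < iter (sodeg P).+1 (fast P p) n.
Proof.
move=> p_mon; set r := fun m => _; have q_mon := @fast_mon P p.
have r_mon : mon r by move=> i j lt_ij; apply: ltn_mul; [apply: p_mon|apply: q_mon].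
apply: leq_ltn_trans
  (level_lt r _ n (fast_gt P p) _ (fast_bound P p) (fast_boundM P p) _).
by apply: sopeval_level => //;
  [apply: fast_gt|apply: fast_bound|apply: fast_boundM].
Qed.

Lemma eq_sopeval P r r' n : r =1 r' -> sopeval P r n = sopeval P r' n.
Proof.
by move=> eq_r; elim: P => //= [P -> Q ->|P -> Q ->|P ->].
Qed.

End Growth.

Section Machine.
Variables (Sigma : finType) (m : nat) (M : oracle_machine Sigma m).
Variables (phi : seq Sigma -> seq Sigma) (us : m.-tuple (seq Sigma)).

Lemma run_halted t t' : t <= t' -> halted (run M phi us t) ->
  run M phi us t' = run M phi us t.
Proof.
move=> /subnK <- halted_t; rewrite /run iterD; set c := iter t _ _.
elim: (t' - t) => //= k ->; rewrite /step.
by rewrite [halted c]halted_t.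
Qed.

(** The head position is carried through the induction because a write at the head may lengthen the
    tape to one cell more than that position. *)
Lemma output_tape_size t :
  size (cells (ctape (run M phi us t) Output)) <= t /\
  head_pos (ctape (run M phi us t) Output) <= t.
Proof.
elim: t => // t; rewrite /run iterS; set c := iter t _ _ => -[le_size le_pos].
rewrite /step; case: ifP => _; first by split; apply: leqW.
case: (ask _) => [q|] /=; first by split; apply: leqW.
rewrite size_set_nth geq_max ltnS le_pos leqW //; split=> //.
by case: (_.2) => //=; [apply: leq_trans (leq_pred _) _|]; apply: leqW.
Qed.

Lemma size_tape_word (t : tape (symbol Sigma (aux M))) :
  size (tape_word t) <= size (cells t).
Proof.
rewrite /tape_word size_pmap; apply: leq_trans (count_size _ _) _.
by rewrite size_take; case: ltnP => // /ltnW.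
Qed.

Lemma size_output N v :
  halts_within M phi us N -> outputs M phi us v -> size v <= N.
Proof.
move=> [t le_tN halted_t] [t' halted_t' <-].
(* The time bound and the output may come with different halting times, but a halted configuration
   no longer changes. *)
have -> : run M phi us t' = run M phi us t.
  by case/orP: (leq_total t t') => le_t; [|symmetry]; apply: run_halted.
apply: leq_trans le_tN; apply: leq_trans (size_tape_word _) _.
by have [] := output_tape_size t.
Qed.

End Machine.

Section RegOfSize.
Variables (Sigma : finType) (a : Sigma) (q : nat -> nat) (q_mon : mon q).

Definition unary_fun (u : seq Sigma) : seq Sigma := nseq (q (size u)) a.

Lemma unary_regular : regular unary_fun.
Proof. by move=> u v le_uv; rewrite !size_nseq; apply: mon_leq. Qed.

Lemma unary_fsize : fsize unary_fun =1 q.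
Proof.
move=> n; rewrite -{1}(size_nseq n a) fsizeE; last exact: unary_regular.
by rewrite !size_nseq.
Qed.

Lemma unary_mon : mon (fsize unary_fun).
Proof. by move=> i j lt_ij; rewrite !unary_fsize; apply: q_mon. Qed.

Definition unary : Reg Sigma := MkReg unary_regular unary_mon.

Lemma size_Phi_unary n u : size (Phi n unary u) = iter n q (size u).
Proof. by rewrite /= /Phi_fun; elim: n => //= n <-; rewrite size_nseq. Qed.

Lemma fsize_reg_pair_unary (pr : pairing Sigma) (psi : Reg Sigma) :
  fsize (reg_pair pr psi unary) =1 fun n => fsize psi n * q n.
Proof.
move=> n; rewrite -[n](size_nseq n a) !fsizeE; try exact: reg_regular.
by rewrite [LHS]size_pair [size (unary _)]size_nseq.
Qed.

End RegOfSize.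

Theorem theorem14 (Sigma : finType) (pr : pairing Sigma)
    (F : Reg Sigma * Reg Sigma -> option (Reg Sigma))
    (M : oracle_machine Sigma 1) (P : sopoly)
    (FM : computes pr M F) (MP : time_bounded M P) :
  ~ exists psi : Reg Sigma, forall phi : Reg Sigma,
      F (psi, phi) = Some (Phi (sodeg P).+1 phi).
Proof.
move=> [psi F_psi]; have [a _] := reg_letter psi.
have q_mon := @fast_mon P (fsize psi).
pose phi := unary _ a _ q_mon.
(* The growth inequality holds at every input length, so the empty word already gives the
   contradiction. *)
have := size_output _ _ _ _ _ _ _ (MP (reg_pair pr psi phi) [::])
  (FM _ _ _ (F_psi phi) [::]).
rewrite size_Phi_unary (eq_sopeval _ _ _ _ (fsize_reg_pair_unary _ _ _ _ _ _)).
by rewrite leqNgt (sopeval_lt_iter_fast _ _ _ (reg_mon psi)).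
Qed.
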